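(* Let $\mathbb{F}$ be a field, let $X$ be an arc of size $2k+1$ of $\mathrm{PG}(k-1,\mathbb{F})$ and let $U$ be the subspace of all quadratic forms on $\mathbb{F}^k$ which are zero on $X$. Let $V(U)$ be the set of points of $\mathrm{PG}(k-1,\mathbb{F})$ which are zeros of all quadratic forms in $U$. If $\dim U\geqslant \binom{k-1}{2}$, then the projection of $V(U)$ from any $k-3$ points of $V(U)$ is contained in a conic.
   Context: $\mathrm{PG}(k-1,\mathbb{F})$ denotes the $(k-1)$-dimensional projective space over the arbitrary field $\mathbb{F}$, with $k\geqslant 3$ (so that $k-3$ points make sense). An arc is a subset $S$ of points of $\mathrm{PG}(k-1,\mathbb{F})$ such that every hyperplane is incident with at most $k-1$ points of $S$. A quadratic form is a homogeneous polynomial of degree $2$ in $X_1,\ldots,X_k$ over $\mathbb{F}$. The projection of $V(U)$ from $k-3$ (distinct) points $P_1,\ldots,P_{k-3}$ of $V(U)$ is the image of $V(U)\setminus\{P_1,\ldots,P_{k-3}\}$ in the plane $\mathrm{PG}(2,\mathbb{F})$ obtained as the quotient of the space by the subspace spanned by $P_1,\ldots,P_{k-3}$. A conic is the set of zeros in $\mathrm{PG}(2,\mathbb{F})$ of a non-zero quadratic form in three variables. *)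

(* Defs.v *)
From HB Require Import structures.
From mathcomp Require Import all_boot all_order all_algebra.
From mathcomp Require Import finmap.
From mathcomp Require Import mpoly.

Set Implicit Arguments.
Unset Strict Implicit.
Unset Printing Implicit Defensive.

Import GRing.Theory.

Local Open Scope fset_scope.
Local Open Scope ring_scope.

(* PG F n is the projective space PG(n, F) of projective dimension n: its
   points are the lines through the origin of F^(n+1). *)
Record PG (F : fieldType) (n : nat) := Point {
  line_of :> {vspace 'rV[F]_n.+1};
  _ : \dim line_of == 1%N
}.

HB.instance Definition _ (F : fieldType) (n : nat) :=
  [isSub for @line_of F n].
HB.instance Definition _ (F : fieldType) (n : nat) :=
  [Choice of PG F n by <:].

Definition is_hyperplane (F : fieldType) (n : nat)
    (H : {vspace 'rV[F]_n.+1}) : bool := \dim H == n.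

Definition is_arc (F : fieldType) (n : nat) (X : {fset PG F n}) : Prop :=
  forall H : {vspace 'rV[F]_n.+1}, is_hyperplane H ->
    (#|` [fset P in X | (P <= H)%VS]| <= n)%N.

(* Quadratic forms in n + 1 variables, the zero form included; [dhomog] carries
   the vector space structure. *)
Notation quadratic_form F n := (dhomog n.+1 F 2).

Definition eval_form (F : fieldType) (n : nat) (q : quadratic_form F n)
    (v : 'rV[F]_n.+1) : F :=
  (mpoly_of_dhomog q).@[fun i => v 0 i].

Definition is_zero (F : fieldType) (n : nat) (q : quadratic_form F n)
    (P : PG F n) : Prop :=
  forall v : 'rV[F]_n.+1, v \in (P : {vspace _}) -> eval_form q v = 0.

(* Each point is represented by the nonzero vector [vpick P]; this choice is
   immaterial, see [forms_vanishing_onP]. *)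
Definition forms_vanishing_on (F : fieldType) (n : nat) (X : {fset PG F n}) :
    {vspace quadratic_form F n} :=
  (\bigcap_(P <- X)
     lker (linfun (fun q : quadratic_form F n =>
                     eval_form q (vpick P) : F^o)))%VS.

Definition zero_locus (F : fieldType) (n : nat)
    (U : {vspace quadratic_form F n}) (P : PG F n) : Prop :=
  forall q, q \in U -> is_zero q P.

Definition span_points (F : fieldType) (n : nat) (S : {fset PG F n}) :
    {vspace 'rV[F]_n.+1} :=
  (\sum_(P <- S) (P : {vspace _}))%VS.

(* A surjective linear map pi : F^(n+1) -> F^3 with kernel W identifies the
   quotient of PG(n, F) by W with PG(2, F). *)
Definition is_quotient_map (F : fieldType) (n : nat) (W : {vspace 'rV[F]_n.+1})
    (pi : 'Hom('rV[F]_n.+1, 'rV[F]_3)) : Prop :=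
  lker pi = W /\ limg pi = fullv.

Definition projection (F : fieldType) (n : nat)
    (pi : 'Hom('rV[F]_n.+1, 'rV[F]_3))
    (V : PG F n -> Prop) (S : {fset PG F n}) (R : PG F 2) : Prop :=
  exists P : PG F n, [/\ V P, P \notin S & (pi @: P)%VS = R].

Definition is_conic (F : fieldType) (C : PG F 2 -> Prop) : Prop :=
  exists2 q : quadratic_form F 2, q != 0 & forall R, C R <-> is_zero q R.

Lemma eval_form_is_linear (F : fieldType) (n : nat) (v : 'rV[F]_n.+1) :
  linear (fun q : quadratic_form F n => eval_form q v : F^o).
Proof.
move=> a p q; rewrite /eval_form.
have -> : mpoly_of_dhomog (a *: p + q : quadratic_form F n) =
  a *: mpoly_of_dhomog p + mpoly_of_dhomog q by exact: linearP.
by rewrite mevalD mevalZ.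
Qed.

Lemma eval_formZ (F : fieldType) (n : nat) (q : quadratic_form F n) a v :
  eval_form q (a *: v) = a ^+ 2 * eval_form q v.
Proof.
rewrite /eval_form [in LHS]mevalE [in RHS]mevalE mulr_sumr big_seq [RHS]big_seq.
apply: eq_bigr => m mq; rewrite mulrCA; congr (_ * _).
have /dhomogP/(_ m mq) /= <- : mpoly_of_dhomog q \is 2.-homog by case: (q).
rewrite mdegE -prodrXr -big_split /=; apply: eq_bigr => i _.
by rewrite mxE exprMn.
Qed.

Lemma is_zero_vpick (F : fieldType) (n : nat) (q : quadratic_form F n)
    (P : PG F n) :
  is_zero q P <-> eval_form q (vpick P) = 0.
Proof.
split=> [|q0 v vP]; first by apply; apply: memv_pick.
have dP : \dim P == 1%N by exact: (valP P).
have /eqP defP : <[vpick P]>%VS == P.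
  rewrite eqEdim -memvE memv_pick (eqP dP) dim_vline vpick0.
  by rewrite -dimv_eq0 (eqP dP).
by move: vP; rewrite -defP => /vlineP[a ->]; rewrite eval_formZ q0 mulr0.
Qed.

Lemma forms_vanishing_onP (F : fieldType) (n : nat) (X : {fset PG F n})
    (q : quadratic_form F n) :
  q \in forms_vanishing_on X <-> (forall P, P \in X -> is_zero q P).
Proof.
have lE P : (q \in lker (linfun (fun q : quadratic_form F n =>
               eval_form q (vpick P) : F^o))) = (eval_form q (vpick P) == 0).
  pose l := GRing.isLinear.Build _ _ _ _ _
    (@eval_form_is_linear F n (vpick P)).
  pose f : {linear quadratic_form F n -> F^o} := HB.pack
    (fun q : quadratic_form F n => eval_form q (vpick P) : F^o) l.
  by rewrite memv_ker (lfunE f).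
rewrite /forms_vanishing_on memvE; split.
  move=> qX P PX; apply/is_zero_vpick/eqP; rewrite -lE memvE.
  by apply: subv_trans qX _; rewrite (big_rem P) //= capvSl.
move=> qX; rewrite big_seq; elim/big_rec: _ => [|P U PX qU].
  exact: subvf.
by rewrite subv_cap qU andbT -memvE lE; apply/eqP/is_zero_vpick/qX.
Qed.

(* Main.v *)
(* Let [n = k - 1].  Products of two hyperplanes show that [2n + 1] points of an
   arc impose independent conditions on quadratic forms, so the bound on the
   dimension says that a form vanishing on [2n + 1] points of [X] vanishes on
   [X], hence on [V(U)]; equivalently, forms vanishing on [2n] points of [X] are
   proportional modulo [U].  Writing [l_A] for a linear form cutting out the
   hyperplane spanned by [n] points [A], this gives, as functions on [V(U)] and
   up to a nonzero constant,
     [l_A l_B = l_A' l_B'] whenever [A + B = A' + B'] has [2n] points.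
   A first consequence is that a point of [V(U)] outside [X] lies on no
   hyperplane spanned by points of [X], so it can replace a point of [X] without
   changing [U]; thus one may assume that [X] contains the points [T] projected
   from.  Now take [p, q, r1, r2, r] in [X \ T] and [n - 1] further points [S]
   of [X].  The identities
     [l_(Tpr1) l_(Sr2) = l_(Tpr2) l_(Sr1)],
     [l_(Tqr1) l_(Sr2) = l_(Tqr2) l_(Sr1)],
   with constants fixed by evaluation at [r], combine into
   [l_(Tpr1) l_(Tqr2) = c l_(Tpr2) l_(Tqr1)], a quadratic cone with vertex
   [<T>] containing [V(U)]; a suitable [S] avoids any given point of [V(U)]. *)
Require Import Defs.
From HB Require Import structures.
From mathcomp Require Import all_boot all_order all_algebra.
From mathcomp Require Import finmap.
From mathcomp Require Import mpoly.
From mathcomp Require Import zify ring.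

Set Implicit Arguments.
Unset Strict Implicit.
Unset Printing Implicit Defensive.

Import GRing.Theory.

Local Open Scope fset_scope.
Local Open Scope ring_scope.

(* Cardinals of sets of points occur with element types [PG F n] and
   [Choice.sort _], which [lia] does not identify before simplification. *)
Ltac card_lia := simpl in *; lia.

(** * Finite sets and the choice of points for the cone *)

Section FiniteSets.

Variable K : choiceType.
Implicit Types (A B C S T X : {fset K}).

Lemma fsubset_of_card A m :
  (m <= #|` A|)%N -> exists2 B, B `<=` A & #|` B| = m.
Proof.
move=> mA; exists [fset x in take m A].
  by apply/fsubsetP=> x; rewrite !inE => /mem_take.
by rewrite card_fseq undup_id ?take_uniq // size_take_min; apply/minn_idPl.
Qed.

Lemma fset_extend_card A X m :
  A `<=` X -> (#|` A| <= m <= #|` X|)%N ->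
  exists B, [/\ A `<=` B, B `<=` X & #|` B| = m].
Proof.
move=> AX /andP[Am mX].
have [|C CXA cC] := @fsubset_of_card (X `\` A) (m - #|` A|).
  by rewrite cardfsDS // leq_sub2r.
exists (A `|` C); split; first exact: fsubsetUl.
  by rewrite fsubUset AX (fsubset_trans CXA) // fsubsetDl.
rewrite cardfsU cC (_ : A `&` C = fset0) ?cardfs0 ?subn0 ?subnKC //.
apply/fsetP=> x; rewrite !inE; apply/negP=> /andP[xA xC].
by move/fsubsetP/(_ x xC): CXA; rewrite !inE xA.
Qed.

Lemma cardfs_exchange A x y :
  x \in A -> y \notin A -> #|` y |` A `\ x| = #|` A|.
Proof.
by move=> xA yA; rewrite cardfsU1 !inE (negPf yA) andbF (cardfsD1 x A) xA.
Qed.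

Lemma fsetUD1C A C x c :
  x \in A -> c \in C -> (c |` A `\ x) `|` (x |` C `\ c) = A `|` C.
Proof.
move=> xA cC; apply/fsetP=> y; rewrite !inE.
have [->|_] := eqVneq y c; first by rewrite cC orbT.
have [->|_] := eqVneq y x; first by rewrite xA orbT.
by [].
Qed.

Lemma fset_pick5 A : (5 <= #|` A|)%N -> exists p q r1 r2 r,
  [/\ p \in A, q \in A, r1 \in A, r2 \in A & r \in A] /\
  uniq [:: p; q; r1; r2; r].
Proof.
case/fsubset_of_card=> B /fsubsetP BA.
have : {subset enum_fset B <= A} := BA; move: (fset_uniq B).
case: (enum_fset B) => [|p [|q [|r1 [|r2 [|r [|? ?]]]]]] // us BA' _.
exists p, q, r1, r2, r; split=> //.
by split; apply: BA'; rewrite !inE eqxx ?orbT.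
Qed.

Lemma fsubset_swap S T x y z :
  (x |` (y |` T)) `|` (z |` S) `<=` (x |` (z |` T)) `|` (y |` S).
Proof.
apply/fsubsetP=> w; rewrite !inE.
by case: (w == x); case: (w == y); case: (w == z); case: (w \in T);
  case: (w \in S).
Qed.

(** Collects all the choices behind the cone. The sets [L x y], and [S] with [r1] or [r2] added,
    span the hyperplanes; [r] serves to fix constants; [S] depends on [P] so as to avoid it. By
    disjointness the two sets in the last clause have [2 * n] points together. *)
Lemma cone_configuration X T n : T `<=` X -> n = #|` T|.+2 ->
  #|` X| = (2 * n + 3)%N ->
  exists p q r1 r2 r, let L x y := x |` (y |` T) in
  [/\ [/\ p \in X, r1 \in X & r \in X],
      r1 \notin L p r2, p \notin L q r1,
      forall x y, x \in [:: p; q] -> y \in [:: r1; r2] ->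
        [/\ L x y `<=` X, #|` L x y| = n & r \notin L x y]
    & forall P, exists S,
      [/\ P \notin S,
          forall y, y \in [:: r1; r2] ->
            [/\ y |` S `<=` X, #|` y |` S| = n & r \notin y |` S]
        & forall x, x \in [:: p; q] -> [disjoint L x r1 & r2 |` S]%fset]].
Proof.
move=> TX cT cX.
have cXT : #|` X `\` T| = (n + 5)%N by rewrite cardfsDS // cX; lia.
have [|p [q [r1 [r2 [r [[pX qX r1X r2X rX] us]]]]]] := @fset_pick5 (X `\` T).
  by rewrite cXT leq_addl.
exists p, q, r1, r2, r => L.
pose E := [fset x in [:: p; q; r1; r2; r]].
have cE : #|` E| = 5%N by rewrite card_fseq undup_id.
have EXT : E `<=` X `\` T.
  apply/fsubsetP=> x; rewrite in_fset !in_cons orbF.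
  by move=> /or4P[|||/orP[]] /eqP ->.
move: us pX qX r1X r2X rX => us' /fsetDP[pX pT] /fsetDP[qX qT].
move=> /fsetDP[r1X r1T] /fsetDP[r2X r2T] /fsetDP[rX rT].
have us := us'; rewrite /= !inE !negb_or !andbT -!andbA in us.
case/and5P: us => pq pr1 pr2 pr /and5P[qr1 qr2 qr r12 /andP[r1r r2r]].
split=> //.
- by rewrite /L !inE !negb_or eq_sym pr1 r12.
- by rewrite /L !inE !negb_or pq pr1.
- move=> x y; rewrite !inE => xpq yr.
  have [xX xT rx] : [/\ x \in X, x \notin T & r != x].
    by case/orP: xpq => /eqP ->; split=> //; rewrite eq_sym.
  have [yX yT ry] : [/\ y \in X, y \notin T & r != y].
    by case/orP: yr => /eqP ->; split=> //; rewrite eq_sym.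
  have xy : x != y by case/orP: xpq => /eqP ->; case/orP: yr => /eqP ->.
  rewrite /L; split.
  + by rewrite !fsubUset !fsub1set xX yX.
  + by rewrite !cardfsU1 !inE negb_or xy xT yT cT add1n.
  + by rewrite !negb_or rx ry.
move=> P.
have [|S SX cS] := @fsubset_of_card (((X `\` T) `\` E) `\ P) n.-1.
  (* Outside [T] and [E] there are [n] points of [X], so [n.-1] remain even if [P] is one of
     them. *)
  have := cardfsD1 P ((X `\` T) `\` E);
  rewrite (cardfsDS EXT) cXT cE addnK => ->.
  by case: (P \in _); rewrite ?leq_pred.
have {}SX x : x \in S -> [/\ x != P, x \notin E, x \notin T & x \in X].
  by move/(fsubsetP SX); rewrite !in_fsetD in_fset1 => /and4P.
have notinS x : x \in E -> x \notin S.
  by move=> xE; apply/negP=> /SX[_]; rewrite xE.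
have /and5P[pS qS r1S r2S rS] :
    [&& p \notin S, q \notin S, r1 \notin S, r2 \notin S & r \notin S].
  by rewrite !notinS // !inE eqxx ?orbT.
exists S; split.
- by apply/negP=> /SX[]; rewrite eqxx.
- move=> y; rewrite !inE => yr.
  have [yX yS ry] : [/\ y \in X, y \notin S & r != y].
    by case/orP: yr => /eqP ->; split=> //; rewrite eq_sym.
  split; last by rewrite negb_or ry.
    rewrite fsubUset fsub1set yX; apply/fsubsetP=> z /SX[] //.
  by rewrite cardfsU1 yS cS cT.
move=> x; rewrite !inE => xpq.
have [xr2 xS] : x != r2 /\ x \notin S by case/orP: xpq => /eqP ->.
apply/fdisjointP=> y; rewrite !inE => /or3P[/eqP->|/eqP->|yT].
- by rewrite negb_or xr2.
- by rewrite negb_or r12.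
rewrite negb_or; apply/andP; split.
  by apply: contraNneq r2T => <-.
by apply/negP=> /SX[_ _]; rewrite yT.
Qed.

End FiniteSets.

(** * Spans of points, hyperplanes and independence *)

Section Span.

Variables (F : fieldType) (n : nat).
Implicit Types (A B C X : {fset PG F n}) (P Q : PG F n).
Implicit Types (W : {vspace 'rV[F]_n.+1}) (v : 'rV[F]_n.+1).

Lemma dim_point P : \dim P = 1%N.
Proof. exact/eqP/(valP P). Qed.

Lemma point_vpick P : (P : {vspace _}) = <[vpick P]>%VS.
Proof.
apply/eqP; rewrite eq_sym eqEdim -memvE memv_pick dim_point dim_vline vpick0.
by rewrite -dimv_eq0 dim_point.
Qed.

Lemma point_subv P W : (P <= W)%VS = (vpick P \in W).
Proof. by rewrite [in LHS]point_vpick memvE. Qed.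

Lemma point_le P Q : (P <= Q)%VS -> P = Q.
Proof. by move=> PQ; apply/val_inj/eqP; rewrite eqEdim /= PQ !dim_point. Qed.

Lemma span_points_subP A W :
  reflect {in A, forall P, (P <= W)%VS} (span_points A <= W)%VS.
Proof.
apply: (iffP idP) => [AW P PA|AW].
  by apply: subv_trans AW; rewrite /span_points (big_rem P) //= addvSl.
rewrite /span_points big_seq; elim/big_rec: _ => [|P U PA UW].
  exact: sub0v.
by rewrite subv_add AW.
Qed.

Lemma point_sub_span P A : P \in A -> (P <= span_points A)%VS.
Proof.
by move=> PA; have /span_points_subP/(_ P PA) := subvv (span_points A).
Qed.

Lemma span_pointsS A B : A `<=` B -> (span_points A <= span_points B)%VS.
Proof.
move=> /fsubsetP AB; apply/span_points_subP=> P PA.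
exact/point_sub_span/AB.
Qed.

Lemma span_pointsU A B :
  span_points (A `|` B) = (span_points A + span_points B)%VS.
Proof.
apply/eqP; rewrite eqEsubv; apply/andP; split.
  apply/span_points_subP=> P; rewrite inE => /orP[]/point_sub_span PA.
    exact: subv_trans PA (addvSl _ _).
  exact: subv_trans PA (addvSr _ _).
by rewrite subv_add !span_pointsS ?fsubsetUl ?fsubsetUr.
Qed.

Lemma span_points1 P : span_points [fset P] = P.
Proof.
apply/eqP; rewrite eqEsubv point_sub_span ?fset11 // andbT.
by apply/span_points_subP=> Q /fset1P ->.
Qed.

Lemma span_points0 : span_points (@fset0 (PG F n)) = 0%VS.
Proof. by rewrite /span_points big_seq_fset0. Qed.

Lemma dim_span_points_le A : (\dim (span_points A) <= #|` A|)%N.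
Proof.
apply: leq_trans (dimv_leq_sum _ _ _) _.
by rewrite (eq_bigr (fun=> 1%N)) ?sum1_size // => P _; apply: dim_point.
Qed.

Definition independent A := \dim (span_points A) == #|` A|.

Lemma independentS A B : A `<=` B -> independent B -> independent A.
Proof.
move=> AB /eqP iB; rewrite /independent eqn_leq dim_span_points_le /=.
have := leq_of_leqif (dimv_add_leqif (span_points A) (span_points (B `\` A))).
rewrite -span_pointsU fsetUDl fsetDv fsetD0 (fsetUidPr _ _ AB) iB.
have := dim_span_points_le (B `\` A); rewrite cardfsDS //.
have := fsubset_leq_card AB.
card_lia.
Qed.

(** All the spans involved have the dimension predicted by cardinality, so Grassmann's formula
    becomes inclusion-exclusion and the obvious inclusion is an equality. *)
Lemma span_points_cap A B C : independent C -> A `<=` C -> B `<=` C ->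
  (span_points A :&: span_points B)%VS = span_points (A `&` B).
Proof.
move=> iC AC BC; apply/esym/eqP; rewrite eqEdim subv_cap.
rewrite !span_pointsS ?fsubsetIl ?fsubsetIr //=.
have iA := eqP (independentS AC iC); have iB := eqP (independentS BC iC).
have ABC : A `|` B `<=` C by rewrite fsubUset AC.
have iU := eqP (independentS ABC iC).
have iI := eqP (independentS (fsubset_trans (fsubsetIl A B) AC) iC).
have := dimv_sum_cap (span_points A) (span_points B).
rewrite -span_pointsU iA iB iU iI.
have := cardfsUI A B; card_lia.
Qed.

(** No point of [A] outside [B] enters the expression of [v] in terms of the independent set [A].
    The induction drops these points one at a time by [span_points_cap]. *)
Lemma span_pointsI A B v : independent A -> B `<=` A ->
  {in A `\` B, forall P, v \in span_points (A `\ P)} ->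
  v \in span_points A -> v \in span_points B.
Proof.
move=> iA BA vP vA.
suff H D : D `<=` A `\` B -> v \in span_points (A `\` D).
  by have := H _ (fsubset_refl _); rewrite fsetDK.
elim/fset1U_rect: D => [|P D PD IH].
  by rewrite fsetD0.
rewrite fsubUset fsub1set => /andP[PAB DAB].
rewrite fsetDUr -(span_points_cap iA) ?fsubsetDl //.
by apply/memv_capP; split; [apply: vP|apply: IH].
Qed.

(** A complement of [W] is a line generated by some [w]. The functional is a coordinate, nonzero at
    [w], of the projection onto this line along [W]. *)
Lemma hyperplane_functional W : is_hyperplane W ->
  exists f : 'Hom('rV[F]_n.+1, F^o), lker f = W.
Proof.
move=> /eqP dW.
have dC : \dim (W^C)%VS = 1%N by rewrite dimv_compl dimvf dim_matrix dW; lia.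
set w := vpick (W^C)%VS.
have w0 : w != 0 by rewrite vpick0 -dimv_eq0 dC.
have CE : (W^C)%VS = <[w]>%VS.
  by apply/eqP; rewrite eq_sym eqEdim -memvE memv_pick dC dim_vline w0.
have [j wj] : exists j, w 0 j != 0.
  apply/existsP; apply: contraR w0 => /existsPn w0.
  by apply/eqP/rowP=> j; rewrite mxE; apply/eqP; move: (w0 j); rewrite negbK.
have cap : (W^C :&: W = 0)%VS by rewrite capvC capv_compl.
have cap' := capv_compl W.
pose g := daddv_pi W^C%VS W.
have glin : linear (fun v => g v 0 j : F^o).
  by move=> a u v; rewrite linearP !mxE.
pose gL : {linear 'rV[F]_n.+1 -> F^o} :=
  HB.pack (fun v => g v 0 j : F^o) (GRing.isLinear.Build _ _ _ _ _ glin).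
exists (linfun gL); apply/vspaceP=> v; rewrite memv_ker lfunE /=.
have vE : g v + daddv_pi W W^C%VS v = v.
  by apply: daddv_pi_add; rewrite // addvC addv_complf memvf.
apply/eqP/idP => [gv0|vW].
  have /vlineP[a ga] : g v \in <[w]>%VS by rewrite -CE memv_pi.
  move: gv0; rewrite ga mxE => /eqP.
  rewrite mulf_eq0 (negPf wj) orbF => /eqP a0.
  by rewrite -vE ga a0 scale0r add0r memv_pi.
move: vE; rewrite (daddv_pi_id cap' vW) => /(canRL (addrK _)) ->.
by rewrite subrr mxE.
Qed.

Lemma hyperplane_extend W : (\dim W <= n)%N ->
  exists2 H : {vspace 'rV[F]_n.+1}, is_hyperplane H & (W <= H)%VS.
Proof.
move=> dW; have [m] := ubnP (n - \dim W)%N; elim: m W dW => // m IH W dW lt.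
have [eqW|neW] := eqVneq (\dim W) n.
  by exists W; rewrite ?subvv /is_hyperplane ?eqW.
have [v vW] : exists v, v \notin W.
  exists (vpick (W^C)%VS); apply/negP=> vW.
  have : vpick (W^C)%VS \in (W :&: W^C)%VS by rewrite memv_cap vW memv_pick.
  rewrite capv_compl memv0 vpick0 -dimv_eq0 dimv_compl dimvf dim_matrix; lia.
have dv : \dim (W + <[v]>)%VS = (\dim W).+1.
  rewrite dimv_disjoint_sum; last first.
    apply/eqP; rewrite -subv0; apply/subvP=> u /memv_capP[uW /vlineP[a ua]].
    move: uW; rewrite ua rpredZeq (negPf vW) orbF => /eqP ->.
    by rewrite scale0r mem0v.
  rewrite dim_vline; case: eqP vW => [->|_]; first by rewrite mem0v.
  by rewrite addn1.
have [||H hH WH] := IH (W + <[v]>)%VS; rewrite ?dv; try lia.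
by exists H => //; apply: subv_trans WH; apply: addvSl.
Qed.

(** Enlarge [A] to [n.+1] points of the arc: if these did not span the whole space, some hyperplane
    would contain all of them. *)
Lemma arc_independent X A : is_arc X -> (n < #|` X|)%N ->
  A `<=` X -> (#|` A| <= n.+1)%N -> independent A.
Proof.
move=> aX nX AX cA.
have [|B [AB BX cB]] := @fset_extend_card _ A X n.+1 AX; first by rewrite cA.
apply: independentS AB _; rewrite /independent eqn_leq dim_span_points_le cB /=.
rewrite leqNgt ltnS; apply/negP=> /hyperplane_extend[H hH BH].
suff BH' : B `<=` [fset P in X | (P <= H)%VS].
  by have := leq_trans (fsubset_leq_card BH') (aX H hH); rewrite cB ltnn.
apply/fsubsetP=> P PB; rewrite !inE /= (fsubsetP BX) //=.
exact: subv_trans (point_sub_span PB) BH.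
Qed.

End Span.

(** * Quadratic forms vanishing on points of an arc *)

Section Forms.

Variables (F : fieldType) (n : nat).
Implicit Types (A B C X Y Z : {fset PG F n}) (P Q : PG F n).
Implicit Types (q : quadratic_form F n) (v : 'rV[F]_n.+1).
Implicit Types (f g : 'Hom('rV[F]_n.+1, F^o)).

Definition linear_poly f : {mpoly F[n.+1]} :=
  \sum_i (f (delta_mx 0 i) : F) *: 'X_i.

Lemma linear_poly_mul_homog f g :
  linear_poly f * linear_poly g \is 2.-homog for [measure of mdeg].
Proof.
have H h : linear_poly h \is 1.-homog for [measure of mdeg].
  by apply: rpred_sum => i _; apply: rpredZ; rewrite dhomogX /= mdeg1.
by have := dhomogM (H f) (H g).
Qed.

Definition prod_form f g : quadratic_form F n :=
  DHomog (linear_poly_mul_homog f g).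

Lemma eval_prod_form f g v :
  eval_form (prod_form f g) v = (f v : F) * (g v : F).
Proof.
have H h : (linear_poly h).@[fun i => v 0 i] = h v.
  rewrite [in RHS](row_sum_delta v) linear_sum raddf_sum /=.
  by apply: eq_bigr => i _; rewrite mevalZ mevalXU linearZ mulrC.
by rewrite /eval_form /= mevalM !H.
Qed.

Lemma eval_form_lincomb a b q r v :
  eval_form (a *: q + b *: r) v = a * eval_form q v + b * eval_form r v.
Proof.
have H := @eval_form_is_linear F n v.
rewrite H; congr (_ + _).
by have := H b r 0; rewrite addr0 /eval_form raddf0 addr0.
Qed.

Lemma forms_vanishing_onE X q :
  q \in forms_vanishing_on X <-> {in X, forall P, eval_form q (vpick P) = 0}.
Proof.
by split=> [/forms_vanishing_onP qX P /qX /is_zero_vpick//|qX];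
  apply/forms_vanishing_onP=> P /qX /is_zero_vpick.
Qed.

Lemma forms_vanishing_onS X Y : X `<=` Y ->
  (forms_vanishing_on Y <= forms_vanishing_on X)%VS.
Proof.
move=> /fsubsetP XY; apply/subvP=> q /forms_vanishing_onE qY.
by apply/forms_vanishing_onE=> P /XY/qY.
Qed.

Lemma arc_notin_span X A P : is_arc X -> (n < #|` X|)%N -> A `<=` X ->
  (#|` A| <= n)%N -> P \in X -> P \notin A -> vpick P \notin span_points A.
Proof.
move=> aX nX AX cA PX PA.
have PAX : P |` A `<=` X by rewrite fsubUset fsub1set PX.
have cPA : #|` P |` A| = #|` A|.+1 by rewrite cardfsU1 PA.
have := arc_independent aX nX PAX; rewrite cPA => /(_ cA) /eqP; rewrite cPA.
apply: contra_eqN; rewrite -point_subv => PsA.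
rewrite span_pointsU span_points1 (addv_idPr PsA).
by have := dim_span_points_le A; lia.
Qed.

Lemma arc_functional X A : is_arc X -> (n < #|` X|)%N -> A `<=` X ->
  #|` A| = n -> exists f, lker f = span_points A.
Proof.
move=> aX nX AX cA; apply: hyperplane_functional.
by have /eqP := arc_independent aX nX AX (leqW (eq_leq cA)); rewrite cA => /eqP.
Qed.

Lemma arc_separating_functional X A P : is_arc X -> (n < #|` X|)%N ->
  A `<=` X ->
  (#|` A| <= n)%N -> P \in X -> P \notin A ->
  exists2 f : 'Hom('rV[F]_n.+1, F^o), f (vpick P) != 0
    & {in A, forall Q, f (vpick Q) = 0}.
Proof.
move=> aX nX AX cA PX PA.
have [||B [AB BXP cB]] := @fset_extend_card _ A (X `\ P) n.
- by rewrite fsubsetD1 AX.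
- by rewrite cA; have := cardfsD1 P X; rewrite PX; card_lia.
have /andP[BX PB] : (B `<=` X) && (P \notin B) by rewrite -fsubsetD1.
have [f kf] := arc_functional aX nX BX cB; exists f.
  by rewrite -memv_ker kf (arc_notin_span aX) ?cB.
move=> Q QA; apply/eqP; rewrite -memv_ker kf -point_subv.
exact/point_sub_span/(fsubsetP AB).
Qed.

(** The at most [2 * n] points of [Z] other than [P] split into two sets of at most [n] points. Each
    lies on a hyperplane missing [P], and [q] is the product of the two linear forms. *)
Lemma arc_separating_form X Z P : is_arc X -> (n < #|` X|)%N -> Z `<=` X ->
  (#|` Z| <= 2 * n + 1)%N -> P \in Z ->
  exists2 q, eval_form q (vpick P) != 0
    & {in Z `\ P, forall Q, eval_form q (vpick Q) = 0}.
Proof.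
move=> aX nX ZX cZ PZ; have PX := fsubsetP ZX P PZ.
have cZP := cardfsD1 P Z; rewrite PZ in cZP.
have [|A AZP cA] := @fsubset_of_card _ (Z `\ P) (minn n #|` Z `\ P|).
  exact: geq_minr.
have PA : P \notin A by move: AZP; rewrite fsubsetD1 => /andP[].
have [||||||f fP fA] := @arc_separating_functional X A P;
  rewrite ?cA ?geq_minl //.
  exact: fsubset_trans AZP (fsubset_trans (fsubD1set _ _) ZX).
have [||||||g gP gB] := @arc_separating_functional X ((Z `\ P) `\` A) P => //.
- exact: fsubset_trans (fsubsetDl _ _) (fsubset_trans (fsubD1set _ _) ZX).
- by rewrite cardfsDS // cA; card_lia.
- by rewrite !inE eqxx andbF.
exists (prod_form f g); first by rewrite eval_prod_form mulf_neq0.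
move=> Q QZ; rewrite eval_prod_form.
have [QA|QA] := boolP (Q \in A); first by rewrite fA // mul0r.
by rewrite gB ?mulr0 // in_fsetD QA.
Qed.

(* At most [2n + 1] points of an arc impose independent conditions on
   quadratic forms. *)
Lemma dim_forms_vanishing_on_arc X Z : is_arc X -> (n < #|` X|)%N ->
  Z `<=` X -> (#|` Z| <= 2 * n + 1)%N ->
  (\dim (forms_vanishing_on Z) + #|` Z| <= 'C(n.+2, 2))%N.
Proof.
move=> aX nX ZX cZ.
suff H D : D `<=` Z ->
    (\dim (forms_vanishing_on D) + #|` D| <= 'C(n.+2, 2))%N.
  exact/H/fsubset_refl.
elim/fset1U_rect: D => [|P D PD IH].
  by rewrite cardfs0 addn0 (leq_trans (dimvS (subvf _))) // dimvf.
rewrite fsubUset fsub1set => /andP[PZ DZ]; rewrite cardfsU1 PD.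
apply: leq_trans (IH DZ); rewrite addnA addn1 leq_add2r.
have sub := forms_vanishing_onS (fsubsetUr [fset P] D).
rewrite ltn_neqAle (dimv_leqif_eq sub) dimvS // andbT.
(* The dimension drops strictly when [P] is added, because the separating form vanishes on [D] but
   not at [P]. *)
have [q qP qZ] := arc_separating_form aX nX ZX cZ PZ.
apply/eqP=> /vspaceP/(_ q) E.
have : q \in forms_vanishing_on D.
  apply/forms_vanishing_onE=> Q QD; apply: qZ.
  by rewrite !inE (fsubsetP DZ) // andbT; apply: contraNneq PD => <-.
by rewrite -E => /forms_vanishing_onE/(_ P (fset1U1 _ _))/eqP; apply/negP.
Qed.

(* The hypotheses of Castelnuovo's lemma, in projective dimension [n]. *)
Definition castelnuovo X := [/\ is_arc X, #|` X| = (2 * n + 3)%N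
  & ('C(n, 2) <= \dim (forms_vanishing_on X))%N].

(** The left side is the dimension of the space of all quadratic forms, so the bound in
    [castelnuovo] says that the forms vanishing on [X] have codimension at most [2 * n + 1]. *)
Lemma bin2_addn2 : 'C(n.+2, 2) = ('C(n, 2) + (2 * n + 1))%N.
Proof. by rewrite !binS !bin0 !bin1; case: n => //=; lia. Qed.

(** The [2 * n + 1] independent conditions imposed by [Z] bound the dimension of the larger space
    above by ['C(n, 2)], which bounds that of the smaller one below. *)
Lemma castelnuovo_forms X Z : castelnuovo X -> Z `<=` X ->
  #|` Z| = (2 * n + 1)%N -> forms_vanishing_on X = forms_vanishing_on Z.
Proof.
move=> [aX cX dX] ZX cZ; apply/eqP.
rewrite eqEdim forms_vanishing_onS //=; apply: leq_trans dX.
have := dim_forms_vanishing_on_arc aX _ ZX; rewrite cX cZ bin2_addn2 => H.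
by rewrite -(leq_add2r (2 * n + 1)); apply: H => //; lia.
Qed.

(* Forms vanishing on [2n] points of [X] are unique up to scaling modulo the
   forms vanishing on [X]. *)
Lemma castelnuovo_proportional X Y q1 q2 P Q : castelnuovo X -> Y `<=` X ->
  #|` Y| = (2 * n)%N ->
  {in Y, forall Q, eval_form q1 (vpick Q) = 0} ->
  {in Y, forall Q, eval_form q2 (vpick Q) = 0} ->
  Q \in X -> Q \notin Y -> zero_locus (forms_vanishing_on X) P ->
  eval_form q1 (vpick Q) * eval_form q2 (vpick P) =
  eval_form q2 (vpick Q) * eval_form q1 (vpick P).
Proof.
move=> hX YX cY q1Y q2Y QX QY PV.
(* The coefficients make the combination vanish at [Q] as well as on [Y], hence on [2 * n + 1]
   points of [X]. *)
pose q := eval_form q1 (vpick Q) *: q2 + - eval_form q2 (vpick Q) *: q1.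
have qU : q \in forms_vanishing_on X.
  rewrite (@castelnuovo_forms X (Q |` Y)) //.
  - apply/forms_vanishing_onE=> R /fset1UP[->|RY].
      by rewrite eval_form_lincomb; ring.
    by rewrite eval_form_lincomb (q1Y R RY) (q2Y R RY); ring.
  - by rewrite fsubUset fsub1set QX.
  by rewrite cardfsU1 QY cY addnC.
have /is_zero_vpick := PV q qU.
rewrite eval_form_lincomb mulNr => /eqP; rewrite subr_eq0 => /eqP //.
Qed.

End Forms.

(** * Exchanging points of the arc with points of the zero locus *)

Section Castelnuovo.

Variables (F : fieldType) (n : nat).
Implicit Types (A B C X Y Z T : {fset PG F n}) (P Q : PG F n).

Lemma prod_form_vanish (f g : 'Hom('rV[F]_n.+1, F^o)) A B Y :
  Y `<=` A `|` B -> lker f = span_points A -> lker g = span_points B ->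
  {in Y, forall Q, eval_form (prod_form f g) (vpick Q) = 0}.
Proof.
move=> /fsubsetP YAB kf kg Q /YAB; rewrite eval_prod_form inE => /orP[QA|QB].
  have : vpick Q \in lker f by rewrite kf -point_subv point_sub_span.
  by rewrite memv_ker => /eqP ->; rewrite mul0r.
have : vpick Q \in lker g by rewrite kg -point_subv point_sub_span.
by rewrite memv_ker => /eqP ->; rewrite mulr0.
Qed.

Lemma castelnuovo_arc X : castelnuovo X -> is_arc X /\ (n < #|` X|)%N.
Proof. by case=> aX cX _; split=> //; rewrite cX; lia. Qed.

(** Both products of linear forms vanish on the [2 * n] points of [A] and [B], so they are
    proportional on the zero locus; evaluation at [R] gives the constant. *)
Lemma castelnuovo_exchange X A B A' B' P R
    (f g f' g' : 'Hom('rV[F]_n.+1, F^o)) : castelnuovo X ->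
  A `<=` X -> B `<=` X -> #|` A| = n -> #|` B| = n -> [disjoint A & B]%fset ->
  A `|` B `<=` A' `|` B' ->
  lker f = span_points A -> lker g = span_points B ->
  lker f' = span_points A' -> lker g' = span_points B' ->
  R \in X -> R \notin A -> R \notin B -> zero_locus (forms_vanishing_on X) P ->
  (f (vpick R) : F) * g (vpick R) * (f' (vpick P) * g' (vpick P)) =
  (f' (vpick R) : F) * g' (vpick R) * (f (vpick P) * g (vpick P)).
Proof.
move=> hX AX BX cA cB dAB sAB kf kg kf' kg' RX RA RB PV.
have ABX : A `|` B `<=` X by rewrite fsubUset AX.
have cAB : #|` A `|` B| = (2 * n)%N.
  by rewrite cardfsU (eqP dAB) cardfs0 subn0 cA cB mul2n addnn.
have RAB : R \notin A `|` B by rewrite in_fsetU negb_or RA.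
have := castelnuovo_proportional hX ABX cAB
  (prod_form_vanish (fsubset_refl _) kf kg) (prod_form_vanish sAB kf' kg')
  RX RAB PV.
by rewrite !eval_prod_form.
Qed.

(* If [P] were in the span of [A], a point [x] of [A] with [P] outside the span
   of [A `\ x] could be exchanged with any point of a disjoint [n]-subset [C]:
   proportionality puts [P] on all hyperplanes spanned by [x] and
   [n - 1] points of [C], and these meet in [x] only. *)
Lemma castelnuovo_notin_span X A P : castelnuovo X ->
  zero_locus (forms_vanishing_on X) P -> A `<=` X -> #|` A| = n ->
  P \notin A -> vpick P \notin span_points A.
Proof.
move=> hX PV AX cA PA; have [aX nX] := castelnuovo_arc hX.
have [PX|PX] := boolP (P \in X); first by rewrite (arc_notin_span aX) ?cA.
apply/negP=> PsA.
have iA : independent A by rewrite (arc_independent aX) ?cA.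
(* As [A] is independent, the spans of [A] minus one point have only 0 in common. *)
have [x xA Px] : exists2 x, x \in A & vpick P \notin span_points (A `\ x).
  apply/(@allPn _ (fun x => vpick P \in span_points (A `\ x))).
  apply/negP=> /allP PAx; have := @span_pointsI _ _ A fset0 (vpick P) iA.
  rewrite fsub0set fsetD0 span_points0 memv0 => /(_ isT PAx PsA).
  by rewrite vpick0 -dimv_eq0 dim_point.
have xX := fsubsetP AX x xA.
have [|C CXA cC] := @fsubset_of_card _ (X `\` A) n.
  by rewrite cardfsDS // cA; case: hX => _ cX _; card_lia.
have /andP[CX dCA] : (C `<=` X) && [disjoint C & A]%fset by rewrite -fsubsetD.
have CA c : c \in C -> c \notin A by move/(fdisjointP dCA).
have xC : x \notin C by apply/negP=> /CA; rewrite xA.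
have dAC : [disjoint A & C]%fset by rewrite fdisjoint_sym.
have [R RXAC] : exists R, R \in X `\` (A `|` C).
  apply/fset0Pn; rewrite -cardfs_gt0 cardfsDS ?fsubUset ?AX // subn_gt0.
  case: hX => _ -> _; apply: leq_ltn_trans (leq_addr #|` A `&` C| _) _.
  by rewrite cardfsUI cA cC addnn -mul2n addnS ltnS leq_addr.
have /fsetDP[RX] := RXAC; rewrite in_fsetU negb_or => /andP[RA RC].
have PC c : c \in C -> vpick P \in span_points (x |` C `\ c).
  move=> cC'; have cX := fsubsetP CX c cC'; have cA' := CA c cC'.
  set A' := c |` A `\ x; set C' := x |` C `\ c.
  have A'X : A' `<=` X.
    by rewrite fsubUset fsub1set cX (fsubset_trans (fsubD1set _ _)).
  have C'X : C' `<=` X.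
    by rewrite fsubUset fsub1set xX (fsubset_trans (fsubD1set _ _)).
  have cA1 : #|` A'| = n by rewrite cardfs_exchange.
  have cC1 : #|` C'| = n by rewrite cardfs_exchange.
  have [fA kA] := arc_functional aX nX AX cA.
  have [fC kC] := arc_functional aX nX CX cC.
  have [fA' kA'] := arc_functional aX nX A'X cA1.
  have [fC' kC'] := arc_functional aX nX C'X cC1.
  have nz (f : 'Hom('rV[F]_n.+1, F^o)) B : lker f = span_points B ->
      B `<=` X -> #|` B| = n -> R \notin B -> f (vpick R) != 0.
    by move=> kf BX cB RB; rewrite -memv_ker kf (arc_notin_span aX) ?cB.
  have sAC : A `|` C `<=` A' `|` C' by rewrite fsetUD1C.
  have /eqP PfA : fA (vpick P) == 0 by rewrite -memv_ker kA.
  have := castelnuovo_exchange hX AX CX cA cC dAC sAC kA kC kA' kC' RX RA RC PV.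
  (* Since [fA] vanishes at [P] while [fA] and [fC] do not vanish at [R], [fA'] or [fC'] vanishes at
     [P]. It is not [fA']: the spans of [A] and [A'] meet in the span of [A] without [x]. *)
  rewrite PfA mul0r mulr0 => /eqP.
  rewrite !mulf_eq0 (negPf (nz _ _ kA AX cA RA)).
  rewrite (negPf (nz _ _ kC CX cC RC)) /=.
  case/orP=> [PA'|PC']; last by rewrite -kC' memv_ker; exact: PC'.
  have {}PA' : vpick P \in span_points A' by rewrite -kA' memv_ker; exact: PA'.
  case/negP: Px.
  have iA' : independent (c |` A).
    apply: arc_independent aX nX _ _; first by rewrite fsubUset fsub1set cX.
    by rewrite cardfsU1 cA' cA.
  have -> : A `\ x = A `&` A'.
    apply/fsetP=> y; rewrite !inE; have [->|_] := eqVneq y c.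
      by rewrite (negPf cA') andbF.
    by rewrite /= andbCA andbb.
  rewrite -(span_points_cap iA') ?fsubsetUr ?fsetUS ?fsubD1set //.
  exact/memv_capP.
have iC : independent (x |` C).
  by apply: arc_independent aX nX _ _;
    rewrite ?fsubUset ?fsub1set ?xX // cardfsU1 xC cC.
have : vpick P \in span_points [fset x].
  apply: (span_pointsI iC); first by rewrite fsubsetUl.
    move=> c /fsetDP[/fset1UP[->|cC'] cx]; first by rewrite fset11 in cx.
    suff -> : (x |` C) `\ c = x |` C `\ c by exact: PC.
    by rewrite fsetDUl mem_fsetD1.
  suff -> : span_points (x |` C) = fullv by rewrite memvf.
  apply/eqP; rewrite eqEdim subvf (eqP iC) dimvf dim_matrix cardfsU1 xC cC.
  by rewrite mul1r; apply: leqnn.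
rewrite span_points1 -point_subv => /point_le Px'.
by rewrite Px' xX in PX.
Qed.

Lemma zero_locus_of_mem X P :
  P \in X -> zero_locus (forms_vanishing_on X) P.
Proof. by move=> PX q /forms_vanishing_onP/(_ P PX). Qed.

(** Turns [castelnuovo_notin_span] into a membership test, by which the cone argument decides where
    its linear forms vanish. *)
Lemma castelnuovo_functional X A : castelnuovo X -> A `<=` X -> #|` A| = n ->
  exists2 f : 'Hom('rV[F]_n.+1, F^o), lker f = span_points A
    & forall P, zero_locus (forms_vanishing_on X) P ->
      ((f (vpick P) : F) == 0) = (P \in A).
Proof.
move=> hX AX cA; have [aX nX] := castelnuovo_arc hX.
have [f kf] := arc_functional aX nX AX cA; exists f => // P PV.
transitivity (vpick P \in lker f); first by rewrite memv_ker.
rewrite kf; apply/idP/idP => [|PA]; last by rewrite -point_subv point_sub_span.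
by apply: contraLR; exact: (castelnuovo_notin_span hX PV AX cA).
Qed.

(** A hyperplane with more than [n] points of the new set would contain [P] and be spanned by [n]
    points of [X], against [castelnuovo_notin_span]. The space of forms can only grow, and the upper
    bound on its dimension for the new arc forbids growth. *)
Lemma castelnuovo_replace X P x : castelnuovo X ->
  zero_locus (forms_vanishing_on X) P -> P \notin X -> x \in X ->
  castelnuovo (P |` X `\ x) /\
  forms_vanishing_on (P |` X `\ x) = forms_vanishing_on X.
Proof.
move=> hX PV PX xX; have [aX nX] := castelnuovo_arc hX.
have [_ cX dX] := hX; set X' := P |` X `\ x.
have XxX : X `\ x `<=` X by exact: fsubD1set.
have cX' : #|` X'| = (2 * n + 3)%N by rewrite cardfs_exchange.
have aX' : is_arc X'.
  move=> H hH; set S := [fset Q in X' | (Q <= H)%VS].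
  rewrite leqNgt; apply/negP=> nS.
  have SP Q : Q \in S -> Q \in X' /\ (Q <= H)%VS.
    by rewrite !inE => /andP.
  have sSP : S `\ P `<=` X.
    apply/fsubsetP=> Q /fsetD1P[QP /SP[/fset1UP[/eqP|/(fsubsetP XxX)//]]].
    by rewrite (negPf QP).
  have [PS|PS] := boolP (P \in S); last first.
    suff SX : S `<=` [fset Q in X | (Q <= H)%VS].
      by have := leq_trans (fsubset_leq_card SX) (aX H hH); rewrite leqNgt nS.
    apply/fsubsetP=> Q QS; have [_ QH] := SP Q QS.
    rewrite !inE /= QH andbT; apply: (fsubsetP sSP).
    by rewrite in_fsetD1 QS andbT; apply: contraNneq PS => <-.
  have [A AS cA] : exists2 A, A `<=` S `\ P & #|` A| = n.
    by apply: fsubset_of_card; have := cardfsD1 P S; rewrite PS; lia.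
  have AX := fsubset_trans AS sSP.
  have PA : P \notin A by apply: contra PX => /(fsubsetP AX).
  case/negP: (castelnuovo_notin_span hX PV AX cA PA).
  suff -> : span_points A = H by rewrite -point_subv; case: (SP P PS).
  apply/eqP; rewrite eqEdim (eqP hH).
  have /eqP -> : independent A by rewrite (arc_independent aX) ?cA.
  rewrite cA leqnn andbT; apply/span_points_subP=> Q QA.
  by have /fsetD1P[_ /SP[]] := fsubsetP AS Q QA.
have sub : (forms_vanishing_on X <= forms_vanishing_on X')%VS.
  apply/subvP=> q qX; apply/forms_vanishing_onE=> Q /fset1UP[->|QX].
    exact/is_zero_vpick/PV.
  by have /forms_vanishing_onE := qX; apply; apply: (fsubsetP XxX).
have dX' := leq_trans dX (dimvS sub).
have hX' : castelnuovo X' by [].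
have [Z ZX' cZ] : exists2 Z, Z `<=` X' & #|` Z| = (2 * n + 1)%N.
  by apply: fsubset_of_card; rewrite cX' leq_add2l.
split=> //; apply/eqP; rewrite eq_sym eqEdim sub /=; apply: leq_trans dX.
rewrite (castelnuovo_forms hX' ZX' cZ).
have := dim_forms_vanishing_on_arc aX' _ ZX'; rewrite cX' cZ bin2_addn2 => H.
by rewrite -(leq_add2r (2 * n + 1)); apply: H => //; lia.
Qed.

(** The points of [T] enter one by one, each in exchange for a point of the arc not among those
    already placed; the zero locus stays the same throughout. *)
Lemma castelnuovo_extend X T : castelnuovo X ->
  {in T, forall P, zero_locus (forms_vanishing_on X) P} ->
  (#|` T| <= 2 * n + 3)%N ->
  exists X', [/\ castelnuovo X', T `<=` X' &
    forms_vanishing_on X' = forms_vanishing_on X].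
Proof.
move=> hX; elim/fset1U_rect: T => [|P T PT IH] TV cT.
  by exists X; split.
move: cT; rewrite cardfsU1 PT add1n => cT.
have [||X0 [hX0 TX0 UX0]] := IH.
- by move=> Q QT; apply/TV/fset1Ur.
- exact: ltnW.
have [PX0|PX0] := boolP (P \in X0).
  by exists X0; split=> //; rewrite fsubUset fsub1set PX0.
have [x /fsetDP[xX0 xT]] : exists x, x \in X0 `\` T.
  apply/fset0Pn; rewrite -cardfs_gt0 cardfsDS // subn_gt0.
  by case: hX0 => _ -> _.
have PV : zero_locus (forms_vanishing_on X0) P.
  by rewrite UX0; apply/TV/fset1U1.
have [hX' UX'] := castelnuovo_replace hX0 PV PX0 xX0.
exists (P |` X0 `\ x); split=> //; last by rewrite UX'.
by rewrite fsetUS // fsubsetD1 TX0.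
Qed.

End Castelnuovo.

(** * The quadratic cone with vertex the span of [T] *)

Section Cone.

Variables (F : fieldType) (n : nat).
Implicit Types (A B C X Y Z S T : {fset PG F n}) (P Q : PG F n).

(** Here [r1] and [r2] trade places. As [g1] and [g2] do not depend on [x], they can be eliminated
    between the cases [x = p] and [x = q]. *)
Lemma cone_swap X S T x r1 r2 R P
    (f1 f2 g1 g2 : 'Hom('rV[F]_n.+1, F^o)) : castelnuovo X ->
  zero_locus (forms_vanishing_on X) P ->
  x |` (r1 |` T) `<=` X -> r2 |` S `<=` X ->
  #|` x |` (r1 |` T)| = n -> #|` r2 |` S| = n ->
  [disjoint x |` (r1 |` T) & r2 |` S]%fset ->
  R \in X -> R \notin x |` (r1 |` T) -> R \notin r2 |` S ->
  lker f1 = span_points (x |` (r1 |` T)) ->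
  lker f2 = span_points (x |` (r2 |` T)) ->
  lker g1 = span_points (r1 |` S) -> lker g2 = span_points (r2 |` S) ->
  (f1 (vpick R) : F) * g2 (vpick R) * (f2 (vpick P) * g1 (vpick P)) =
  (f2 (vpick R) : F) * g1 (vpick R) * (f1 (vpick P) * g2 (vpick P)).
Proof.
move=> hX PV AX BX cA cB dAB RX RA RB kf1 kf2 kg1 kg2.
have sAB := fsubset_swap S T x r1 r2.
exact: (castelnuovo_exchange hX AX BX cA cB dAB sAB
  kf1 kg2 kf2 kg1 RX RA RB PV).
Qed.

Lemma castelnuovo_cone X T : castelnuovo X -> T `<=` X -> n = #|` T|.+2 ->
  exists (f1 g1 f2 g2 : 'Hom('rV[F]_n.+1, F^o)) (a b : F),
  let q := a *: prod_form f1 g1 + b *: prod_form f2 g2 in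
  [/\ [/\ (span_points T <= lker f1)%VS, (span_points T <= lker g1)%VS,
          (span_points T <= lker f2)%VS & (span_points T <= lker g2)%VS],
      exists v, eval_form q v != 0
    & forall P, zero_locus (forms_vanishing_on X) P ->
        eval_form q (vpick P) = 0].
Proof.
move=> hX TX cT; have [_ cX _] := hX.
have [p [q [r1 [r2 [r [[pX r1X rX] r1L pL LX LS]]]]]] :=
  cone_configuration TX cT cX.
have ip : p \in [:: p; q] by rewrite mem_head.
have iq : q \in [:: p; q] by rewrite in_cons mem_seq1 eqxx orbT.
have ir1 : r1 \in [:: r1; r2] by rewrite mem_head.
have ir2 : r2 \in [:: r1; r2] by rewrite in_cons mem_seq1 eqxx orbT.
have [p1X cp1 rp1] := LX p r1 ip ir1; have [p2X cp2 rp2] := LX p r2 ip ir2.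
have [q1X cq1 rq1] := LX q r1 iq ir1; have [q2X cq2 rq2] := LX q r2 iq ir2.
have [f1 kf1 zf1] := castelnuovo_functional hX p1X cp1.
have [f2 kf2 zf2] := castelnuovo_functional hX p2X cp2.
have [g1 kg1 zg1] := castelnuovo_functional hX q1X cq1.
have [g2 kg2 zg2] := castelnuovo_functional hX q2X cq2.
have xV := @zero_locus_of_mem _ _ X.
have inL1 x y : x \in x |` (y |` T) by exact: fset1U1.
have inL2 x y : y \in x |` (y |` T) by exact/fset1Ur/fset1U1.
pose a : F := (f1 (vpick r) : F) * g2 (vpick r).
pose b : F := (f2 (vpick r) : F) * g1 (vpick r).
exists f2, g1, f1, g2, a, (- b) => Q.
have QE v : eval_form Q v =
    a * ((f2 v : F) * g1 v) - b * ((f1 v : F) * g2 v).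
  by rewrite eval_form_lincomb !eval_prod_form mulNr.
split.
- have sTL x y : (span_points T <= span_points (x |` (y |` T)))%VS.
    by apply: span_pointsS; rewrite fsetUA fsubsetUr.
  by split; [rewrite kf2|rewrite kg1|rewrite kf1|rewrite kg2]; apply: sTL.
(* [f1] vanishes at both [p] and [r1], which kills the second product. In the first, [f2] vanishes
   at [p] and [g1] at [r1], so what is left is [f2] at [r1] times [g1] at [p], both nonzero. *)
- exists (vpick p + vpick r1); rewrite QE.
  have vE (f : 'Hom('rV[F]_n.+1, F^o)) P P' : (f (vpick P') : F) = 0 ->
      (f (vpick P + vpick P') : F) = f (vpick P).
    by move=> fP; have := linearD f (vpick P) (vpick P'); rewrite /= fP addr0.
  have f1p : (f1 (vpick p) : F) = 0.
    by apply/eqP; rewrite (zf1 _ (xV _ pX)) inL1.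
  have f1r : (f1 (vpick r1) : F) = 0.
    by apply/eqP; rewrite (zf1 _ (xV _ r1X)) inL2.
  have f2p : (f2 (vpick p) : F) = 0.
    by apply/eqP; rewrite (zf2 _ (xV _ pX)) inL1.
  have g1r : (g1 (vpick r1) : F) = 0.
    by apply/eqP; rewrite (zg1 _ (xV _ r1X)) inL2.
  rewrite (vE f1 _ _ f1r) (vE g1 _ _ g1r) f1p mul0r mulr0 subr0.
  rewrite addrC (vE f2 _ _ f2p).
  have n1 : (f1 (vpick r) : F) != 0 by rewrite (zf1 _ (xV _ rX)) (negPf rp1).
  have n2 : (g2 (vpick r) : F) != 0 by rewrite (zg2 _ (xV _ rX)) (negPf rq2).
  have n3 : (f2 (vpick r1) : F) != 0 by rewrite (zf2 _ (xV _ r1X)) (negPf r1L).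
  have n4 : (g1 (vpick p) : F) != 0 by rewrite (zg1 _ (xV _ pX)) (negPf pL).
  exact: mulf_neq0 (mulf_neq0 n1 n2) (mulf_neq0 n3 n4).
move=> P PV; rewrite QE.
(* Whatever [S] is, the factors [s1] and [s2] cancelled below vanish at [r1] and [r2] respectively.
   At these two points both products in [Q] are zero. *)
have [->|Pr1] := eqVneq P r1.
  have /eqP -> : (f1 (vpick r1) : F) == 0 by rewrite (zf1 _ (xV _ r1X)) inL2.
  have /eqP -> : (g1 (vpick r1) : F) == 0 by rewrite (zg1 _ (xV _ r1X)) inL2.
  by rewrite !(mul0r, mulr0) subr0.
have [Pr2|Pr2] := eqVneq P r2.
  have /eqP -> : (f2 (vpick P) : F) == 0 by rewrite (zf2 _ PV) Pr2 inL2.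
  have /eqP -> : (g2 (vpick P) : F) == 0 by rewrite (zg2 _ PV) Pr2 inL2.
  by rewrite !(mul0r, mulr0) subr0.
have [S [PS SX dS]] := LS P.
have [S1X cS1 rS1] := SX r1 ir1; have [S2X cS2 rS2] := SX r2 ir2.
have [s1 ks1 zs1] := castelnuovo_functional hX S1X cS1.
have [s2 ks2 zs2] := castelnuovo_functional hX S2X cS2.
have Hp := cone_swap hX PV p1X S2X cp1 cS2 (dS p ip) rX rp1 rS2 kf1 kf2 ks1 ks2.
have Hq := cone_swap hX PV q1X S2X cq1 cS2 (dS q iq) rX rq1 rS2 kg1 kg2 ks1 ks2.
have nzs (x : PG F n) : P != x -> P \notin x |` S.
  by move=> Px; apply/negP=> /fset1UP[/eqP|]; [rewrite (negPf Px)|exact/negP].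
have s1P : (s1 (vpick P) : F) != 0 by rewrite (zs1 _ PV) nzs.
have s2P : (s2 (vpick P) : F) != 0 by rewrite (zs2 _ PV) nzs.
have s1r : (s1 (vpick r) : F) != 0 by rewrite (zs1 _ (xV _ rX)) (negPf rS1).
have s2r : (s2 (vpick r) : F) != 0 by rewrite (zs2 _ (xV _ rX)) (negPf rS2).
rewrite /a /b; move: Hp Hq s1P s2P s1r s2r.
move: (f1 (vpick r) : F) (f2 (vpick r) : F) (g1 (vpick r) : F)
  (g2 (vpick r) : F) (s1 (vpick r) : F) (s2 (vpick r) : F).
move: (f1 (vpick P) : F) (f2 (vpick P) : F) (g1 (vpick P) : F)
  (g2 (vpick P) : F) (s1 (vpick P) : F) (s2 (vpick P) : F).
move=> f1P f2P g1P g2P s1P s2P f1r f2r g1r g2r s1r s2r Hp Hq n1 n2 n3 n4.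
(* After multiplication by this nonzero factor, the difference regroups as left side of [Hp] times
   right side of [Hq], minus right side of [Hp] times left side of [Hq]. *)
apply: (mulfI (mulf_neq0 (mulf_neq0 n1 n2) (mulf_neq0 n3 n4))).
have -> : s1P * s2P * (s1r * s2r) * (f1r * g2r * (f2P * g1P) -
     f2r * g1r * (f1P * g2P)) =
   (f1r * s2r * (f2P * s1P)) * (g2r * s1r * (g1P * s2P)) -
   (f2r * s1r * (f1P * s2P)) * (g1r * s2r * (g2P * s1P)) by ring.
by rewrite Hp Hq; ring.
Qed.

End Cone.

(** * Descent to the quotient plane *)

Lemma factor_lfun (F : fieldType) (aT bT cT : vectType F)
    (pi : 'Hom(aT, bT)) (f : 'Hom(aT, cT)) v :
  (lker pi <= lker f)%VS -> (f \o pi^-1)%VF (pi v) = f v.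
Proof.
(* [pi^-1] recovers [v] only up to an element of [lker pi], on which [f] vanishes. *)
move=> /subvP sub; rewrite comp_lfunE; apply/eqP; rewrite -subr_eq0 -linearB /=.
rewrite -memv_ker; apply: sub.
by rewrite memv_ker linearB /= limg_lfunVK ?subrr // memv_img ?memvf.
Qed.

Theorem theorem5 (F : fieldType) (k : nat) (hk : (3 <= k)%N)
    (X : {fset PG F k.-1})
    (hX : is_arc X)
    (hXsize : #|` X| = (2 * k + 1)%N)
    (hU : ('C(k.-1, 2) <= \dim (forms_vanishing_on X))%N)
    (T : {fset PG F k.-1})
    (hS : forall P, P \in T -> zero_locus (forms_vanishing_on X) P)
    (hSsize : #|` T| = (k - 3)%N) :
  [/\ \dim (span_points T) = (k - 3)%N,
      (forall P, zero_locus (forms_vanishing_on X) P -> P \notin T ->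
         ~~ (P <= span_points T)%VS)
    & forall pi : 'Hom('rV[F]_(k.-1.+1), 'rV[F]_3),
        is_quotient_map (span_points T) pi ->
        exists2 C : PG F 2 -> Prop, is_conic C &
          forall R, projection pi (zero_locus (forms_vanishing_on X)) T R ->
            C R].
Proof.
have ek : k = k.-1.+1 by rewrite prednK // (leq_trans _ hk).
set n := k.-1 in X hX hXsize hU T hS hSsize ek *.
have cX : #|` X| = (2 * n + 3)%N by rewrite hXsize ek; lia.
have cT : n = #|` T|.+2 by rewrite hSsize; lia.
have hC : castelnuovo X by split.
have nk : (#|` T| <= n)%N by rewrite hSsize; lia.
have [|X0 [hX0 TX0 UX0]] := castelnuovo_extend hC (hS : {in T, forall P, _}).
  by apply: leq_trans nk _; lia.
have [aX0 nX0] := castelnuovo_arc hX0.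
split.
- by rewrite -hSsize; apply/eqP/(arc_independent aX0 nX0 TX0)/leqW.
- move=> P PV PT.
  (* [T] with [P] added also lies on an arc of this kind, and points of an arc are independent. *)
  have [||X1 [hX1 TX1 _]] := @castelnuovo_extend _ _ X (P |` T) hC.
  + by move=> Q /fset1UP[->|/hS].
  + by rewrite cardfsU1 PT; apply: leq_trans (leq_add (leqnn 1%N) nk) _; lia.
  have [aX1 nX1] := castelnuovo_arc hX1.
  move: TX1; rewrite fsubUset fsub1set => /andP[PX1 TX1].
  by rewrite point_subv (arc_notin_span aX1 nX1 TX1 nk PX1 PT).
move=> pi [kpi _].
have [f1 [g1 [f2 [g2 [a [b]]]]]] := castelnuovo_cone hX0 TX0 cT.
set q := _ + _ => -[[kf1 kg1 kf2 kg2] [v qv] qV].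
(* The four linear forms vanish on the kernel of [pi], so they descend to the plane and [q] descends
   with them. The result is nonzero because its pullback [q] is nonzero at [v]. *)
pose d f : 'Hom('rV[F]_3, F^o) := (f \o pi^-1)%VF.
pose q' : quadratic_form F 2 :=
  a *: prod_form (d f1) (d g1) + b *: prod_form (d f2) (d g2).
have q'E w : eval_form q' (pi w) = eval_form q w.
  rewrite /q' /q !eval_form_lincomb !eval_prod_form /d.
  by rewrite !factor_lfun ?kpi.
exists (is_zero q').
  exists q' => //; apply: contraNneq qv => q'0; rewrite -q'E q'0.
  by rewrite /eval_form raddf0.
move=> R [P [PV _ piP]] w; rewrite -piP => /memv_imgP[u uP ->].
rewrite q'E; move: u uP; apply/is_zero_vpick/qV.
by rewrite UX0.
Qed.
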